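(* Let $p>3$ be a prime and let $G$ be a non-abelian group of order $p^5$ of nilpotency class at least $3$ such that $\mathrm{cd}(G) = \{ 1, p, p^2 \}$. Then $\mathrm{cod}(G) = \{ 1, p, p^2, p^3 \}$.
   Context: For an irreducible complex character $\chi$ of a finite group $G$, its codegree is $\mathrm{cod}(\chi) = |G:\ker\chi|/\chi(1)$, and $\mathrm{cod}(G) = \{\mathrm{cod}(\chi) : \chi \in \mathrm{Irr}(G)\}$. $\mathrm{cd}(G) = \{\chi(1) : \chi\in\mathrm{Irr}(G)\}$ is the set of irreducible complex character degrees. *)

(* Defs.v *)
From mathcomp Require Import all_boot all_order all_algebra all_fingroup.
From mathcomp Require Import all_solvable all_field all_character.

Set Implicit Arguments.
Unset Strict Implicit.
Unset Printing Implicit Defensive.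

Import Order.TTheory GRing.Theory Num.Theory.
Local Open Scope ring_scope.

Definition codegree (gT : finGroupType) (G : {group gT}) (chi : 'CF(G)) : algC :=
  #|G : cfker chi|%g%:R / chi 1%g.

(* cd(G) and cod(G) are sequences of values, possibly with repetitions; the
   sets they stand for are compared with the extensional equality =i. *)
Definition cd (gT : finGroupType) (G : {group gT}) : seq algC :=
  [seq 'chi[G]_i 1%g | i : Iirr G].

Definition cod (gT : finGroupType) (G : {group gT}) : seq algC :=
  [seq codegree 'chi[G]_i | i : Iirr G].

(* Main.v *)
Require Import Defs.
From mathcomp Require Import all_boot all_order all_algebra all_fingroup.
From mathcomp Require Import all_solvable all_field all_character.

(* A character of degree p^2 forces |Z(G)| = p, and is faithful and fully
   ramified over Z(G); Galois conjugacy then gives every faithful irreducible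
   character degree p^2. So characters of degree p contain Z(G) in their kernel,
   and linear ones have codegree at most |G : G'| <= p^3 as Z(G) < G', so all
   codegrees are at most p^3. If p^2 were not a codegree, all characters of
   degree p would have kernel Z(G). For such a chi, Z(chi)/Z(G) = Z(G/Z(G)) is
   cyclic, and its exponent divides p = |Z(G)|, so |G : Z(chi)| = p^3; but
   G/Z(chi) has only linear characters, so p^2 = chi(1)^2 = |G : Z(chi)|, a
   contradiction. *)

Set Implicit Arguments.
Unset Strict Implicit.
Unset Printing Implicit Defensive.

Import Order.TTheory GRing.Theory Num.Theory.
Local Open Scope ring_scope.

(** Faithfulness makes ['Z('chi_i)%CF] equal to the centre, where ['chi_i] is its degree times a
    linear character [lam]; take [w = lam z]. If [w] has order [m], then [z ^+ m] lies in the
    trivial kernel, so [m] is the order of [z]. *)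
Lemma fful_irr_center_cycle (gT : finGroupType) (G : {group gT}) (i : Iirr G)
    (z : gT) :
    cfaithful 'chi_i -> 'Z(G)%g = <[z]>%g ->
  exists2 w : algC, #[z]%g.-primitive_root w
    & forall k, 'chi_i (z ^+ k)%g = 'chi_i 1%g * w ^+ k.
Proof.
move=> fful_i defZ; have defZi := cfcenter_fful_irr fful_i.
have [lam Llam resZ] := cfcenter_Res 'chi_i.
have Zz k : (z ^+ k)%g \in 'Z('chi_i)%CF by rewrite defZi defZ mem_cycle.
have chiE k : 'chi_i (z ^+ k)%g = 'chi_i 1%g * lam z ^+ k.
  rewrite -(lin_charX Llam) ?(Zz 1%N) //.
  by rewrite -(cfResE _ (cfcenter_sub _) (Zz k)) resZ cfunE.
have [m prim_m m_dv] :=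
  prim_order_exists (order_gt0 z) (lin_char_unity_root Llam (Zz 1%N)).
exists (lam z) => //; suffices -> : #[z]%g = m by [].
apply/eqP; rewrite eqn_dvd m_dv andbT order_dvdn -in_set1.
apply: (subsetP fful_i); rewrite cfkerEirr inE chiE.
by rewrite (prim_expr_order prim_m) mulr1.
Qed.

(* Both central characters are faithful on the cyclic centre, hence Galois
   conjugate; the corresponding conjugate of 'chi_i vanishes off the centre, so
   its inner product with 'chi_j is nonzero and the two must coincide. *)
Lemma fful_irr1_fully_ramified (gT : finGroupType) (G : {group gT})
    (i j : Iirr G) :
    cfaithful 'chi_i -> cfaithful 'chi_j ->
    'chi_i 1%g ^+ 2 = #|G : 'Z(G)|%g%:R ->
  'chi_j 1%g = 'chi_i 1%g.
Proof.
move=> fful_i fful_j deg_i; have defZi := cfcenter_fful_irr fful_i.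
have [z defZ] : exists z, 'Z(G)%g = <[z]>%g.
  apply/cyclicP; rewrite -defZi; have := cfcenter_cyclic 'chi_i.
  have /trivgP-> := fful_i.
  by rewrite -(isog_cyclic (quotient1_isog _)).
have [w w_prim chi_iE] := fful_irr_center_cycle fful_i defZ.
have [v v_prim chi_jE] := fful_irr_center_cycle fful_j defZ.
have [e v_def] := prim_rootP w_prim (prim_expr_order v_prim).
have co_e : coprime e #[z]%g.
  by rewrite -(prim_root_exp_coprime _ w_prim) -v_def.
have [u uE] := Qn_aut_exists co_e.
(* The hypothesis on the degree is the equality case of [irr1_bound], which characterises vanishing
   off the centre. *)
have off_i : 'chi_i \in 'CF(G, 'Z(G)).
  have := (irr1_bound i).2.
  by rewrite defZi deg_i eqxx.
have uw : u w = v by rewrite v_def uE ?(prim_expr_order w_prim).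
have u1 : u ('chi_i 1%g) = 'chi_i 1%g by rewrite irr1_degree rmorph_nat.
have v1 : v * v^* = 1.
  rewrite -normCK (_ : `|v| = 1) ?expr1n //.
  apply/eqP; rewrite -(@pexpr_eq1 _ _ #[z]%g) ?order_gt0 //.
  by rewrite -normrX (prim_expr_order v_prim) normr1.
have : '['chi_(aut_Iirr u i), 'chi_j] != 0.
  rewrite aut_IirrE (@cfdotEl _ _ 'Z(G)%g) ?cfAut_on //.
  rewrite (eq_bigr (fun=> 'chi_i 1%g * 'chi_j 1%g)) => [|x]; last first.
    rewrite defZ => /cycleP[k ->]; rewrite cfunE chi_iE chi_jE !rmorphM !rmorphXn.
    rewrite /= uw u1 (irr1_degree j) conjC_nat mulrACA -exprMn.
    by rewrite v1 expr1n mulr1.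
  rewrite sumr_const mulf_neq0 ?invr_eq0 ?neq0CG //.
  by rewrite mulrn_eq0 mulf_eq0 !(negPf (irr1_neq0 _)) eqn0Ngt cardG_gt0.
rewrite cfdot_irr pnatr_eq0 eqb0 negbK => /eqP <-.
by rewrite aut_IirrE cfunE.
Qed.

Lemma center_prime_sub_normal (gT : finGroupType) (G N : {group gT}) :
    nilpotent G -> prime #|'Z(G)|%g -> (N <| G)%g -> N != 1%g :> {set gT} ->
  'Z(G)%g \subset N.
Proof.
move=> nilG prZ nsNG ntN; apply: prime_meetG => //.
by rewrite setIC meet_center_nil.
Qed.

(** If [x] is central modulo the centre, every [[~ x, y]] is central, so [[~ x ^+ n, y] = [~ x, y]
    ^+ n]; this is trivial when [n] is the exponent of the centre, and then [x ^+ n] is central. *)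
Lemma exponent_center_quotient_center (gT : finGroupType) (G : {group gT}) :
  (exponent 'Z(G / 'Z(G)) %| exponent 'Z(G))%N.
Proof.
apply/exponentP=> xZ /centerP[/morphimP[x Nx Gx ->] cGx].
rewrite -morphX //=; apply: coset_id; apply/centerP.
split=> [|y Gy]; first exact: groupX.
have Ny : y \in 'N('Z(G))%g by apply: subsetP Gy; apply: gFnorm.
have Zxy : [~ x, y]%g \in 'Z(G)%g.
  apply: coset_idr; first by rewrite groupR.
  by rewrite /= morphR //; apply/eqP/commgP/cGx/mem_morphim.
apply/commgP; rewrite commXg ?(expg_exponent Zxy) //.
by have /centerP[_ cG] := Zxy; apply/commute_sym/cG.
Qed.

(** The quotient of the two groups is the centre of [G / cfker 'chi_i], a nilpotent group that is
    nontrivial as [i != 0]. *)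
Lemma cfker_proper_cfcenter (gT : finGroupType) (G : {group gT}) (i : Iirr G) :
  nilpotent G -> i != 0 -> cfker 'chi_i \proper 'Z('chi_i)%CF.
Proof.
move=> nilG nz_i; have nsKG := cfker_normal 'chi_i.
rewrite properEneq (normal_sub (cfker_center_normal _)) andbT.
apply: contra nz_i => /eqP eqKZ; rewrite -subGcfker.
rewrite -quotient_sub1 ?normal_norm // subG1
  -(center_nil_eq1 (quotient_nil _ nilG)).
by rewrite -cfcenter_eq_center -eqKZ trivg_quotient.
Qed.

Theorem lemma3p6 (gT : finGroupType) (G : {group gT}) (p : nat)
  (p_prime : prime p) (p_gt3 : (3 < p)%N)
  (nonabG : ~~ abelian G) (oG : #|G| = (p ^ 5)%N)
  (clG : (3 <= nil_class G)%N)
  (cdG : cd G =i [:: 1; p%:R; p%:R ^+ 2]) :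
  cod G =i [:: 1; p%:R; p%:R ^+ 2; p%:R ^+ 3].
Proof.
have p_gt1 := prime_gt1 p_prime; have p_gt0 := prime_gt0 p_prime.
have pG : p.-group%g G by rewrite /pgroup oG pnatX pnat_id.
have nilG := pgroup_nil pG.
have p_neq0 : p%:R != 0 :> algC by rewrite pnatr_eq0 -lt0n.
have degP i : [|| 'chi[G]_i 1%g == 1, 'chi_i 1%g == p%:R | 'chi_i 1%g == p%:R ^+ 2].
  have : 'chi_i 1%g \in cd G by apply: image_f.
  by rewrite cdG !inE.
have indexP (H : {group gT}) : H \subset G ->
    exists2 b, #|G : H|%g = (p ^ b)%N & (#|H| * p ^ b = p ^ 5)%N.
  move=> sHG; have : (#|G : H|%g %| p ^ 5)%N by rewrite -oG dvdn_indexg.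
  case/(dvdn_pfactor _ _ p_prime) => b _ indH; exists b => //.
  by rewrite -indH Lagrange.
have p_inj m n : (p ^ m = p ^ n)%N -> m = n
  by move/eqP; rewrite eqn_exp2l // => /eqP.
have [i2 deg_i2] : exists i, 'chi[G]_i 1%g = p%:R ^+ 2.
  have : p%:R ^+ 2 \in cd G by rewrite cdG !inE eqxx !orbT.
  by case/imageP=> i _ ->; exists i.
have [i1 deg_i1] : exists i, 'chi[G]_i 1%g = p%:R.
  have : p%:R \in cd G by rewrite cdG !inE eqxx !orbT.
  by case/imageP=> i _ ->; exists i.
have sZZ i : 'Z(G)%g \subset 'Z('chi[G]_i)%CF.
  by rewrite -cap_cfcenter_irr (bigcap_min i).
have Z_gt1 : (1 < #|'Z(G)|%g)%N.
  rewrite cardG_gt1 (center_nil_eq1 nilG).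
  by apply: contraNneq nonabG => ->; apply: abelian1.
(* With index [p ^ b], the degree bound gives [4 <= b], and the nontrivial centre of [G] gives
   [b < 5]. *)
have deg2_center i : 'chi[G]_i 1%g = p%:R ^+ 2 -> #|'Z('chi_i)%CF| = p.
  move=> deg_i; have [b indb cardb] := indexP _ (cfcenter_sub 'chi_i).
  have := (irr1_bound i).1; rewrite deg_i indb -exprM -natrX ler_nat leq_exp2l //.
  have := leq_trans Z_gt1 (subset_leq_card (sZZ i)) => ZZ_gt1 b_ge4.
  have : (b < 5)%N.
    rewrite -(ltn_exp2l _ _ p_gt1) -cardb -[ltnLHS]mul1n.
    by rewrite ltn_pmul2r // expn_gt0 p_gt0.
  rewrite ltnS => b_le4; have b4 : b = 4 by apply/eqP; rewrite eqn_leq b_le4.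
  apply/eqP; rewrite -(eqn_pmul2r (_ : 0 < p ^ b)%N) ?expn_gt0 ?p_gt0 //.
  by rewrite cardb b4 -expnS.
have oZ : #|'Z(G)|%g = p.
  have := cardSg (sZZ i2); rewrite (deg2_center _ deg_i2) => /prime_nt_dvdP.
  by apply=> //; rewrite neq_ltn Z_gt1 orbT.
have prZ : prime #|'Z(G)|%g by rewrite oZ.
have sub_Z := center_prime_sub_normal nilG prZ.
have nz_deg i : 'chi[G]_i 1%g != 1 -> i != 0.
  by apply: contraNneq => ->; rewrite irr0 cfun1E group1.
have p_neq1 : p%:R != 1 :> algC by rewrite pnatr_eq1 gtn_eqF.
have p2_neq1 : p%:R ^+ 2 != 1 :> algC.
  by rewrite -natrX pnatr_eq1 -(expn0 p) eqn_exp2l.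
(* A nontrivial kernel would contain the centre of [G], of order [p], yet be proper in
   ['Z('chi_i)%CF], also of order [p]. *)
have deg2_fful i : 'chi[G]_i 1%g = p%:R ^+ 2 -> cfaithful 'chi_i.
  move=> deg_i; have /nz_deg nz_i : 'chi_i 1%g != 1 by rewrite deg_i.
  have ltKZ := proper_card (cfker_proper_cfcenter nilG nz_i).
  apply: contraLR ltKZ => ntK; rewrite -leqNgt deg2_center // -oZ.
  apply: subset_leq_card; apply: sub_Z; first exact: cfker_normal.
  by rewrite -subG1.
have p_expr_inj m n : (p%:R ^+ m = p%:R ^+ n :> algC) -> m = n.
  by rewrite -!natrX => /eqP; rewrite eqr_nat => /eqP/p_inj.
have ram_i2 : 'chi_i2 1%g ^+ 2 = #|G : 'Z(G)|%g%:R.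
  rewrite deg_i2 -exprM -natrX; congr _%:R; apply/eqP.
  by rewrite -(eqn_pmul2l (ltnW Z_gt1)) Lagrange ?center_sub // oG oZ -expnS.
have deg1_Z i : 'chi[G]_i 1%g = p%:R -> 'Z(G)%g \subset cfker 'chi_i.
  move=> deg_i; apply: sub_Z; first exact: cfker_normal.
  apply/eqP=> K1; have fful_i : cfaithful 'chi_i by rewrite cfaithfulE K1.
  have := fful_irr1_fully_ramified (deg2_fful _ deg_i2) fful_i ram_i2.
  by rewrite deg_i deg_i2 -[LHS]expr1 => /p_expr_inj.
have der_index : (#|G : G^`(1)%g|%g %| p ^ 3)%N.
  (* Class at least 3 says that the derived subgroup is not central. *)
  have sZG' : 'Z(G)%g \proper G^`(1)%g.
    rewrite properE sub_Z ?der_normal //= -?nil_class2 -?ltnNge //.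
    by apply: contra nonabG => /eqP/derG1P.
  have [b -> cardb] := indexP _ (der_sub 1 G).
  rewrite dvdn_Pexp2l // -ltnS -(ltn_exp2l _ _ p_gt1) -(ltn_pmul2l p_gt0).
  by rewrite -(expnS p 4) -cardb ltn_pmul2r ?expn_gt0 ?p_gt0 //
    -[ltnLHS]oZ proper_card.
have codE i b : #|G : cfker 'chi_i|%g = (p ^ b)%N ->
    codegree 'chi[G]_i = (p ^ b)%:R / 'chi_i 1%g by rewrite /codegree => ->.
(* The exponent [b] is above 2 because the kernel is proper in ['Z('chi_i)%CF], whose index is at
   least [p ^ 2], and below 5 because the kernel contains the centre of [G]. *)
have deg1_index i : 'chi[G]_i 1%g = p%:R ->
     #|G : cfker 'chi_i|%g = (p ^ 3)%N \/ #|G : cfker 'chi_i|%g = (p ^ 4)%N.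
  move=> deg_i; have sKG := normal_sub (cfker_normal 'chi_i).
  have [b -> cardb] := indexP _ sKG; suffices : (2 < b < 5)%N.
    by case: b {cardb} => [|[|[|[|[]]]]] // _; [left | right].
  have [c indc cardc] := indexP _ (cfcenter_sub 'chi_i).
  have nz_i : i != 0 by apply: nz_deg; rewrite deg_i.
  have /proper_card ltKZ := cfker_proper_cfcenter nilG nz_i.
  have := (irr1_bound i).1; rewrite deg_i indc -natrX ler_nat.
  rewrite leq_exp2l // => c_ge2.
  rewrite (leq_ltn_trans c_ge2) /=.
    rewrite ltnS -(leq_exp2l _ _ p_gt1) -(leq_pmul2l p_gt0).
    by rewrite -(expnS p 4) -cardb leq_pmul2r ?expn_gt0 ?p_gt0 //
      -[leqLHS]oZ subset_leq_card ?deg1_Z.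
  rewrite -(ltn_exp2l _ _ p_gt1) -(ltn_pmul2l (cardG_gt0 (cfker 'chi_i)))
    cardb -cardc.
  by rewrite ltn_pmul2r ?expn_gt0 ?p_gt0.
have divp m : (p ^ m.+1)%:R / p%:R = p%:R ^+ m :> algC.
  by rewrite natrX exprSr mulfK.
have deg2_cod i : 'chi[G]_i 1%g = p%:R ^+ 2 -> codegree 'chi_i = p%:R ^+ 3.
  move=> deg_i; rewrite /codegree deg_i; have /trivgP -> := deg2_fful _ deg_i.
  by rewrite indexg1 oG natrX (exprD _ 3 2) mulfK ?expf_neq0.
move=> x; apply/imageP/idP => [[i _ ->]|].
  have [b indb cardb] := indexP _ (normal_sub (cfker_normal 'chi_i)).
  case/or3P: (degP i) => /eqP deg_i.
  - rewrite (codE _ _ indb) deg_i divr1.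
    have : (p ^ b %| p ^ 3)%N.
      rewrite -indb (dvdn_trans _ der_index) // indexgS // -lin_irr_der1.
      by rewrite qualifE /= irr_char deg_i eqxx.
    rewrite dvdn_Pexp2l //; clear; case: b => [|[|[|[]]]] // _;
      by rewrite natrX !inE eqxx ?orbT.
  - rewrite /codegree deg_i; case: (deg1_index _ deg_i) => ->;
      by rewrite divp !inE eqxx ?orbT.
  by rewrite deg2_cod // !inE eqxx !orbT.
rewrite !inE => /or4P[] /eqP->.
- exists 0 => //; rewrite /codegree irr0 cfker_cfun1 indexgg cfun11 divr1 //.
(* Codegree [p] comes from a nonprincipal character of [G / M], cyclic of order [p], inflated to
   [G]. *)
- have [eqG1 | [M maxM _]] := maximal_exists (sub1G G).
    by rewrite -eqG1 abelian1 in nonabG.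
  have nsMG := p_maximal_normal pG maxM; have iM := p_maximal_index pG maxM.
  have prGM : prime #|G / M|%g by rewrite card_quotient ?normal_norm ?iM.
  have ntGM : (G / M)%g != 1%g by rewrite -cardG_gt1 prime_gt1.
  have [j nz_j] := has_nonprincipal_irr ntGM; exists (mod_Iirr j) => //.
  have /andP[_ /eqP lin_j] := irr_prime_lin j prGM.
  rewrite /codegree mod_IirrE // cfMod1 lin_j divr1; congr _%:R; symmetry.
  apply/(prime_nt_dvdP p_prime); last by rewrite -iM indexgS ?cfker_mod.
  by rewrite -mod_IirrE // indexg_eq1 subGcfker mod_Iirr_eq0.
(* Codegree [p ^ 2] is sought in degree [p] with kernel of index [p ^ 3]; otherwise that index is
   always [p ^ 4], which forces the kernel to be the centre. *)
- have [/existsP[i /andP[/eqP deg_i /eqP indK]] | no_i] := boolP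
    [exists i, ('chi[G]_i 1%g == p%:R) && (#|G : cfker 'chi_i|%g == p ^ 3)%N].
    exists i => //; by rewrite /codegree indK deg_i divp.
  have deg1_ker i : 'chi[G]_i 1%g = p%:R -> cfker 'chi_i = 'Z(G)%g.
    move=> deg_i; have [indK|indK] := deg1_index _ deg_i.
      by case/existsP: no_i; exists i; rewrite deg_i indK !eqxx.
    apply/eqP; rewrite eq_sym eqEcard deg1_Z //= oZ.
    rewrite -(leq_pmul2r (_ : 0 < p ^ 4)%N) ?expn_gt0 ?p_gt0 //.
    by rewrite -{1}indK Lagrange ?(normal_sub (cfker_normal _)) // oG expnS.
  have defK := deg1_ker _ deg_i1.
  have nz_i1 : i1 != 0 by apply: nz_deg; rewrite deg_i1.
  have ltZY := cfker_proper_cfcenter nilG nz_i1; rewrite defK in ltZY.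
  set Y := ('Z('chi_i1))%CF in ltZY.
  have nsYG : (Y <| G)%g := cfcenter_normal _.
  have Y_Z : #|Y : 'Z(G)|%g = p.
    have nZY : Y \subset 'N('Z(G))%g.
      by apply: subset_trans (cfcenter_sub _) (gFnorm _ _).
    have := cfcenter_cyclic 'chi_i1; rewrite -/Y defK => cycYZ.
    apply/(prime_nt_dvdP p_prime).
      by rewrite indexg_eq1; case/andP: ltZY.
    have : (exponent (Y / 'Z(G)) %| #|'Z(G)|%g)%N.
      rewrite -defK cfcenter_eq_center defK.
      apply: dvdn_trans (exponent_center_quotient_center G) _.
      exact: exponent_dvdn.
    by rewrite exponent_cyclic // card_quotient // oZ.
  (* An irreducible character of [G / Y] inflates to one whose kernel contains [Y]. Since [Y] is
     larger than the centre, degree [p] (kernel the centre) and degree [p ^ 2] (trivial kernel) are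
     excluded. *)
  have abGY : abelian (G / Y)%g.
    apply/char_abelianP=> j; rewrite qualifE /= irr_char -cfMod1 -mod_IirrE //.
    have sYK : Y \subset cfker 'chi_(mod_Iirr j) by rewrite mod_IirrE ?cfker_mod.
    case/or3P: (degP (mod_Iirr j)) => // /eqP deg_j.
      by rewrite (deg1_ker _ deg_j) in sYK; case/andP: ltZY => _ /negP.
    have := subset_trans sYK (deg2_fful _ deg_j) => sY1.
    by case/andP: ltZY => _ /negP[]; apply: subset_trans sY1 (sub1G _).
  (* Now [Y] has index [p ^ 2] and order [p ^ 2], against [#|G| = p ^ 5]. *)
  have := irr1_abelian_bound abGY; rewrite deg_i1.
  have [b -> cardb] := indexP _ (normal_sub nsYG).
  rewrite natrX => /p_expr_inj b2; rewrite -b2 in cardb.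
  have oY : #|Y| = (p ^ 2)%N.
    by rewrite -(Lagrange (_ : 'Z(G)%g \subset Y)) ?sZZ // oZ Y_Z mulnn.
  by move: cardb; rewrite oY -expnD => /p_inj.
by exists i2 => //; rewrite deg2_cod.
Qed.
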